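(* Let $\gamma>0$, $\epsilon>0$ and $\Omega\in\mathbb{R}$ with $\Omega > 2\gamma+4\epsilon$. For every initial data $(A^{(0)},B^{(0)})\in\ell^2(\mathbb{Z})\times\ell^2(\mathbb{Z})$ there is a constant $C>0$ (allowed to depend on $\Omega,\gamma,\epsilon$ and on the initial data, but not on $\tau$) such that the unique solution $(A,B)\in C^1(\mathbb{R},\ell^2(\mathbb{Z})\times\ell^2(\mathbb{Z}))$ of the coupled system $$\left\{\begin{array}{l} i\,\frac{dA_n}{d\tau}=\epsilon(A_{n+1}-2A_n+A_{n-1})+\Omega A_n+\gamma(\bar B_n-\bar A_n)+\frac12|A_n|^2A_n,\\ i\,\frac{dB_n}{d\tau}=\epsilon(B_{n+1}-2B_n+B_{n-1})+\Omega B_n+\gamma(\bar A_n-\bar B_n)+\frac12|B_n|^2B_n,\end{array}\right.\qquad n\in\mathbb{Z},$$ with $(A,B)(0)=(A^{(0)},B^{(0)})$ satisfies $$\|A(\tau)\|_{\ell^2}^2+\|B(\tau)\|_{\ell^2}^2\le C\qquad\text{for every }\tau\in\mathbb{R}.$$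
   Context: Here $\ell^2(\mathbb{Z})$ is the space of square-summable complex sequences $A=(A_n)_{n\in\mathbb{Z}}$ with norm $\|A\|_{\ell^2}^2=\sum_{n\in\mathbb{Z}}|A_n|^2$; the bar denotes complex conjugation. Time $\tau$ is real and $C^1(\mathbb{R},X)$ denotes continuously differentiable functions of $\tau$ with values in the Banach space $X$ (regarded as a real Banach space, since the system is not complex-linear). The Cauchy problem for the system is globally well posed: for every initial data in $\ell^2(\mathbb{Z})\times\ell^2(\mathbb{Z})$ there is a unique solution in $C^1(\mathbb{R},\ell^2(\mathbb{Z})\times\ell^2(\mathbb{Z}))$. *)

(* Defs.v *)
From Stdlib Require Export Reals ZArith.
From Stdlib Require Import Lra Lia Psatz FunctionalExtensionality ProofIrrelevance.
From Coquelicot Require Export Coquelicot.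
Open Scope R_scope.

Definition zpos (f : Z -> R) (k : nat) : R := f (Z.of_nat k).
Definition zneg (f : Z -> R) (k : nat) : R := f (- Z.of_nat (S k))%Z.

Definition ex_seriesZ (f : Z -> R) : Prop :=
  ex_series (zpos f) /\ ex_series (zneg f).

Definition SeriesZ (f : Z -> R) : R := Series (zpos f) + Series (zneg f).

Lemma ex_series_le_pos (a b : nat -> R) :
  (forall k, 0 <= a k <= b k) -> ex_series b -> ex_series a.
Proof.
  intros H Hb. apply (ex_series_le (K := R_AbsRing) (V := R_CompleteNormedModule) a b); auto.
  intros k. change (Rabs (a k) <= b k). rewrite Rabs_pos_eq; apply H.
Qed.

Lemma ex_seriesZ_le (f g : Z -> R) :
  (forall n, 0 <= f n <= g n) -> ex_seriesZ g -> ex_seriesZ f.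
Proof.
  intros H [Hp Hn]; split.
  - apply ex_series_le_pos with (zpos g); [intros k; apply H | exact Hp].
  - apply ex_series_le_pos with (zneg g); [intros k; apply H | exact Hn].
Qed.

Lemma ex_seriesZ_plus (f g : Z -> R) :
  ex_seriesZ f -> ex_seriesZ g -> ex_seriesZ (fun n => f n + g n).
Proof.
  intros [F1 F2] [G1 G2]; split.
  - exact (ex_series_plus (V := R_NormedModule) _ _ F1 G1).
  - exact (ex_series_plus (V := R_NormedModule) _ _ F2 G2).
Qed.

Lemma ex_seriesZ_scal (c : R) (f : Z -> R) :
  ex_seriesZ f -> ex_seriesZ (fun n => c * f n).
Proof.
  intros [F1 F2]; split.
  - exact (ex_series_scal (V := R_NormedModule) c _ F1).
  - exact (ex_series_scal (V := R_NormedModule) c _ F2).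
Qed.

Lemma SeriesZ_plus (f g : Z -> R) : ex_seriesZ f -> ex_seriesZ g ->
  SeriesZ (fun n => f n + g n) = SeriesZ f + SeriesZ g.
Proof.
  intros [F1 F2] [G1 G2]. unfold SeriesZ.
  change (zpos (fun n => f n + g n)) with (fun k => zpos f k + zpos g k).
  change (zneg (fun n => f n + g n)) with (fun k => zneg f k + zneg g k).
  rewrite !Series_plus; auto. ring.
Qed.

Lemma SeriesZ_scal (c : R) (f : Z -> R) :
  SeriesZ (fun n => c * f n) = c * SeriesZ f.
Proof.
  unfold SeriesZ.
  change (zpos (fun n => c * f n)) with (fun k => c * zpos f k).
  change (zneg (fun n => c * f n)) with (fun k => c * zneg f k).
  rewrite !Series_scal_l. ring.
Qed.

Lemma SeriesZ_le (f g : Z -> R) :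
  (forall n, 0 <= f n <= g n) -> ex_seriesZ g -> SeriesZ f <= SeriesZ g.
Proof.
  intros H [Hp Hn]. apply Rplus_le_compat; apply Series_le; auto; intros k; apply H.
Qed.

Lemma Series_zero : Series (fun _ : nat => 0) = 0.
Proof.
  rewrite (Series_ext _ (fun _ => 0 * 0)) by (intros; ring).
  rewrite Series_scal_l; ring.
Qed.

Lemma SeriesZ_pos (f : Z -> R) : (forall n, 0 <= f n) -> ex_seriesZ f -> 0 <= SeriesZ f.
Proof.
  intros H Hf. pose proof (SeriesZ_le (fun _ => 0) f) as L.
  unfold SeriesZ at 1, zpos, zneg in L. rewrite Series_zero in L.
  rewrite <- (Rplus_0_l 0). apply L; auto. intros n; split; [lra | apply H].
Qed.

Lemma term_le_Series (a : nat -> R) (k : nat) :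
  (forall j, 0 <= a j) -> ex_series a -> a k <= Series a.
Proof.
  intros H Ha.
  apply Rle_trans with (sum_n a k).
  - destruct k as [|k]; [rewrite sum_O; lra|].
    rewrite sum_Sn. change (a (S k) <= sum_n a k + a (S k)).
    assert (0 <= sum_n a k); [|lra].
    induction k as [|k IH]; [rewrite sum_O; apply H|].
    rewrite sum_Sn. change (0 <= sum_n a k + a (S k)). specialize (H (S k)). lra.
  - apply (is_lim_seq_incr_compare (sum_n a) (Series a)).
    + exact (Series_correct a Ha).
    + intros n. rewrite sum_Sn. change (sum_n a n <= sum_n a n + a (S n)).
      specialize (H (S n)). lra.
Qed.

Lemma term_le_SeriesZ (f : Z -> R) (n : Z) :
  (forall m, 0 <= f m) -> ex_seriesZ f -> f n <= SeriesZ f.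
Proof.
  intros H [Hp Hn]. unfold SeriesZ.
  assert (P : forall k, zpos f k <= Series (zpos f))
    by (intros k; apply term_le_Series; auto; intros j; apply H).
  assert (N : forall k, zneg f k <= Series (zneg f))
    by (intros k; apply term_le_Series; auto; intros j; apply H).
  assert (P0 := P O). assert (N0 := N O).
  assert (0 <= zpos f O) by apply H. assert (0 <= zneg f O) by apply H.
  destruct (Z_le_gt_dec 0 n) as [Hz|Hz].
  - specialize (P (Z.to_nat n)). unfold zpos at 1 in P. rewrite Z2Nat.id in P by lia. lra.
  - specialize (N (Z.to_nat (- n - 1))). unfold zneg at 1 in N.
    replace (- Z.of_nat (S (Z.to_nat (- n - 1))))%Z with n in N by lia. lra.
Qed.

Definition normsq (A : Z -> C) : R := SeriesZ (fun n => Cmod (A n) ^ 2).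

Record ell2 : Type := mk_ell2 {
  ell2_seq :> Z -> C;
  ell2_summable : ex_seriesZ (fun n => Cmod (ell2_seq n) ^ 2)
}.

Lemma ell2_ext (A B : ell2) : (forall n, A n = B n) -> A = B.
Proof.
  destruct A as [a ha], B as [b hb]; simpl; intros H.
  assert (E : a = b) by (apply functional_extensionality; auto).
  subst b. f_equal. apply proof_irrelevance.
Qed.

Lemma Cmod_plus_sq (t : R) (x y : C) : 0 < t ->
  Cmod (x + y)%C ^ 2 <= (1 + t) * Cmod x ^ 2 + (1 + / t) * Cmod y ^ 2.
Proof.
  intros Ht. pose proof (Cmod_triangle x y). pose proof (Cmod_ge_0 (x + y)%C).
  pose proof (Cmod_ge_0 x). pose proof (Cmod_ge_0 y).
  apply Rle_trans with ((Cmod x + Cmod y) ^ 2); [nra|].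
  assert (Hs : 0 <= / t * (t * Cmod x - Cmod y) ^ 2).
  { apply Rmult_le_pos; [left; now apply Rinv_0_lt_compat | apply pow2_ge_0]. }
  replace (/ t * (t * Cmod x - Cmod y) ^ 2)
    with (t * Cmod x ^ 2 - 2 * Cmod x * Cmod y + / t * Cmod y ^ 2) in Hs by (field; lra).
  nra.
Qed.

Lemma ell2_plus_summable (A B : ell2) :
  ex_seriesZ (fun n => Cmod (A n + B n)%C ^ 2).
Proof.
  apply ex_seriesZ_le with (fun n => (1 + 1) * Cmod (A n) ^ 2 + (1 + / 1) * Cmod (B n) ^ 2).
  - intros n; split; [apply pow2_ge_0 | apply Cmod_plus_sq; lra].
  - apply ex_seriesZ_plus; apply ex_seriesZ_scal; apply ell2_summable.
Qed.

Lemma ell2_zero_summable : ex_seriesZ (fun _ => Cmod 0 ^ 2).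
Proof.
  assert (ex_series (fun _ : nat => Cmod 0 ^ 2)).
  { exists 0. rewrite Cmod_0. change (is_lim_seq (sum_n (fun _ => 0 ^ 2)) 0).
    apply is_lim_seq_ext with (fun _ => 0); [|apply is_lim_seq_const].
    intros n. rewrite sum_n_const. ring. }
  now split.
Qed.

Lemma ell2_opp_summable (A : ell2) : ex_seriesZ (fun n => Cmod (- A n)%C ^ 2).
Proof.
  apply ex_seriesZ_le with (fun n => Cmod (A n) ^ 2); [|apply ell2_summable].
  intros n; rewrite Cmod_opp; split; [apply pow2_ge_0 | apply Rle_refl].
Qed.

Lemma Cmod_scal_sq (c : R) (x : C) : Cmod (c * x)%C ^ 2 = c ^ 2 * Cmod x ^ 2.
Proof. rewrite Cmod_mult, Cmod_R, Rpow_mult_distr, pow2_abs. reflexivity. Qed.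

Lemma ell2_scal_summable (c : R) (A : ell2) : ex_seriesZ (fun n => Cmod (c * A n)%C ^ 2).
Proof.
  apply ex_seriesZ_le with (fun n => c ^ 2 * Cmod (A n) ^ 2);
    [|apply ex_seriesZ_scal, ell2_summable].
  intros n; rewrite Cmod_scal_sq; split; [|apply Rle_refl].
  apply Rmult_le_pos; apply pow2_ge_0.
Qed.

Definition ell2_plus (A B : ell2) : ell2 := mk_ell2 _ (ell2_plus_summable A B).
Definition ell2_zero : ell2 := mk_ell2 _ ell2_zero_summable.
Definition ell2_opp (A : ell2) : ell2 := mk_ell2 _ (ell2_opp_summable A).
(* Only real scalars: the lattice system involves conjugates and is not complex-linear. *)
Definition ell2_scal (c : R) (A : ell2) : ell2 := mk_ell2 _ (ell2_scal_summable c A).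

Definition ell2_norm (A : ell2) : R := sqrt (normsq A).

Lemma normsq_ge0 (A : ell2) : 0 <= normsq A.
Proof. apply SeriesZ_pos; [intros n; apply pow2_ge_0 | apply ell2_summable]. Qed.

Lemma ell2_norm_sq (A : ell2) : ell2_norm A ^ 2 = normsq A.
Proof. apply pow2_sqrt, normsq_ge0. Qed.

Lemma ell2_norm_ge0 (A : ell2) : 0 <= ell2_norm A.
Proof. apply sqrt_pos. Qed.

Lemma ell2_norm_eq0 (A : ell2) : ell2_norm A = 0 -> A = ell2_zero.
Proof.
  intros H. apply ell2_ext; intros n; simpl.
  assert (E : normsq A = 0) by (rewrite <- ell2_norm_sq, H; ring).
  apply Cmod_eq_0.
  pose proof (term_le_SeriesZ (fun n => Cmod (A n) ^ 2) n
    (fun m => pow2_ge_0 _) (ell2_summable A)) as L.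
  fold (normsq A) in L. rewrite E in L. simpl in L.
  pose proof (Cmod_ge_0 (A n)). nra.
Qed.

Lemma normsq_plus_le (t : R) (A B : ell2) : 0 < t ->
  normsq (ell2_plus A B) <= (1 + t) * normsq A + (1 + / t) * normsq B.
Proof.
  intros Ht. unfold normsq at 2 3.
  rewrite <- !SeriesZ_scal, <- SeriesZ_plus by apply ex_seriesZ_scal, ell2_summable.
  apply SeriesZ_le.
  - intros n; split; [apply pow2_ge_0 | now apply Cmod_plus_sq].
  - apply ex_seriesZ_plus; apply ex_seriesZ_scal; apply ell2_summable.
Qed.

Lemma ell2_norm_triangle (A B : ell2) :
  ell2_norm (ell2_plus A B) <= ell2_norm A + ell2_norm B.
Proof.
  pose proof (ell2_norm_ge0 A) as a0. pose proof (ell2_norm_ge0 B) as b0.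
  destruct (Req_dec (ell2_norm A) 0) as [HA|HA].
  { apply ell2_norm_eq0 in HA as E. rewrite HA, Rplus_0_l, E.
    right; f_equal. apply ell2_ext; intros n; simpl. ring. }
  destruct (Req_dec (ell2_norm B) 0) as [HB|HB].
  { apply ell2_norm_eq0 in HB as E. rewrite HB, Rplus_0_r, E.
    right; f_equal. apply ell2_ext; intros n; simpl. ring. }
  apply Rsqr_incr_0_var; [|lra]. rewrite !Rsqr_pow2, ell2_norm_sq.
  assert (t0 : 0 < ell2_norm B / ell2_norm A) by (apply Rdiv_lt_0_compat; lra).
  eapply Rle_trans; [apply (normsq_plus_le _ A B t0)|].
  rewrite <- !ell2_norm_sq. right. field. split; assumption.
Qed.

Lemma ell2_norm_scal (c : R) (A : ell2) :
  ell2_norm (ell2_scal c A) = Rabs c * ell2_norm A.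
Proof.
  unfold ell2_norm.
  assert (E : normsq (ell2_scal c A) = c ^ 2 * normsq A).
  { unfold normsq. rewrite <- SeriesZ_scal. unfold SeriesZ.
    f_equal; apply Series_ext; intros k; apply Cmod_scal_sq. }
  rewrite E, sqrt_mult_alt by apply pow2_ge_0.
  f_equal. rewrite <- Rsqr_pow2. apply sqrt_Rsqr_abs.
Qed.

Lemma ell2_plus_comm (A B : ell2) : ell2_plus A B = ell2_plus B A.
Proof. apply ell2_ext; intros n; simpl; ring. Qed.
Lemma ell2_plus_assoc (A B D : ell2) :
  ell2_plus A (ell2_plus B D) = ell2_plus (ell2_plus A B) D.
Proof. apply ell2_ext; intros n; simpl; ring. Qed.
Lemma ell2_plus_zero_r (A : ell2) : ell2_plus A ell2_zero = A.
Proof. apply ell2_ext; intros n; simpl; ring. Qed.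
Lemma ell2_plus_opp_r (A : ell2) : ell2_plus A (ell2_opp A) = ell2_zero.
Proof. apply ell2_ext; intros n; simpl; ring. Qed.

Definition ell2_AbelianMonoid_mixin :=
  AbelianMonoid.Mixin ell2 ell2_plus ell2_zero
    ell2_plus_comm ell2_plus_assoc ell2_plus_zero_r.
Canonical ell2_AbelianMonoid :=
  AbelianMonoid.Pack ell2 ell2_AbelianMonoid_mixin ell2.

Definition ell2_AbelianGroup_mixin :=
  AbelianGroup.Mixin ell2_AbelianMonoid ell2_opp ell2_plus_opp_r.
Canonical ell2_AbelianGroup :=
  AbelianGroup.Pack ell2
    (AbelianGroup.Class ell2 ell2_AbelianMonoid_mixin ell2_AbelianGroup_mixin) ell2.

Lemma ell2_scal_assoc (x y : R) (A : ell2) :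
  ell2_scal x (ell2_scal y A) = ell2_scal (x * y) A.
Proof. apply ell2_ext; intros n; simpl. rewrite RtoC_mult; ring. Qed.
Lemma ell2_scal_one (A : ell2) : ell2_scal 1 A = A.
Proof. apply ell2_ext; intros n; simpl; ring. Qed.
Lemma ell2_scal_distr_l (x : R) (A B : ell2) :
  ell2_scal x (ell2_plus A B) = ell2_plus (ell2_scal x A) (ell2_scal x B).
Proof. apply ell2_ext; intros n; simpl; ring. Qed.
Lemma ell2_scal_distr_r (x y : R) (A : ell2) :
  ell2_scal (x + y) A = ell2_plus (ell2_scal x A) (ell2_scal y A).
Proof. apply ell2_ext; intros n; simpl. rewrite RtoC_plus; ring. Qed.

Definition ell2_ModuleSpace_mixin :=
  ModuleSpace.Mixin R_Ring ell2_AbelianGroup ell2_scal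
    ell2_scal_assoc ell2_scal_one ell2_scal_distr_l ell2_scal_distr_r.
Canonical ell2_ModuleSpace :=
  ModuleSpace.Pack R_Ring ell2
    (ModuleSpace.Class R_Ring ell2 (AbelianGroup.class ell2_AbelianGroup)
       ell2_ModuleSpace_mixin) ell2.

Definition ell2_ball (A : ell2) (e : R) (B : ell2) : Prop := ell2_norm (minus B A) < e.

Lemma ell2_ball_center (A : ell2) (e : posreal) : ell2_ball A e A.
Proof.
  unfold ell2_ball.
  replace (minus A A) with (ell2_scal 0 A) by (apply ell2_ext; intros n; simpl; ring).
  rewrite ell2_norm_scal, Rabs_R0, Rmult_0_l. apply cond_pos.
Qed.

Lemma ell2_ball_sym (A B : ell2) (e : R) : ell2_ball A e B -> ell2_ball B e A.
Proof.
  unfold ell2_ball. intros H.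
  replace (minus A B) with (ell2_scal (Ropp 1) (minus B A)).
  - rewrite ell2_norm_scal, Rabs_Ropp, Rabs_R1, Rmult_1_l. exact H.
  - apply ell2_ext; intros n; simpl. rewrite RtoC_opp; ring.
Qed.

Lemma ell2_ball_triangle (A B D : ell2) (e1 e2 : R) :
  ell2_ball A e1 B -> ell2_ball B e2 D -> ell2_ball A (e1 + e2) D.
Proof.
  unfold ell2_ball. intros H1 H2.
  replace (minus D A) with (ell2_plus (minus D B) (minus B A)).
  - eapply Rle_lt_trans; [apply ell2_norm_triangle | lra].
  - apply ell2_ext; intros n; simpl. ring.
Qed.

Definition ell2_UniformSpace_mixin :=
  UniformSpace.Mixin ell2 ell2_zero ell2_ball
    ell2_ball_center ell2_ball_sym ell2_ball_triangle.
Canonical ell2_UniformSpace :=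
  UniformSpace.Pack ell2 ell2_UniformSpace_mixin ell2.

Canonical ell2_NormedModuleAux :=
  NormedModuleAux.Pack R_AbsRing ell2
    (NormedModuleAux.Class R_AbsRing ell2
       (ModuleSpace.class R_Ring ell2_ModuleSpace) ell2_UniformSpace_mixin) ell2.

Lemma ell2_norm_scal_le (l : R) (A : ell2) :
  ell2_norm (ell2_scal l A) <= Rabs l * ell2_norm A.
Proof. rewrite ell2_norm_scal. apply Rle_refl. Qed.
Lemma ell2_norm_compat1 (A B : ell2) (e : R) :
  ell2_norm (minus B A) < e -> ell2_ball A e B.
Proof. intros H; exact H. Qed.
Lemma ell2_norm_compat2 (A B : ell2) (e : posreal) :
  ell2_ball A e B -> ell2_norm (minus B A) < 1 * e.
Proof. rewrite Rmult_1_l. intros H; exact H. Qed.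

Definition ell2_NormedModule_mixin :=
  NormedModule.Mixin R_AbsRing ell2_NormedModuleAux ell2_norm 1
    ell2_norm_triangle ell2_norm_scal_le ell2_norm_compat1 ell2_norm_compat2 ell2_norm_eq0.
Canonical ell2_NormedModule :=
  NormedModule.Pack R_AbsRing ell2
    (NormedModule.Class R_AbsRing ell2
       (NormedModuleAux.class R_AbsRing ell2_NormedModuleAux) ell2_NormedModule_mixin) ell2.

Definition is_C1 {V : NormedModule R_AbsRing} (f f' : R -> V) : Prop :=
  (forall t : R, is_derive f t (f' t)) /\ (forall t : R, continuous f' t).

(* Right-hand side of the equation for [A]; the one for [B] is obtained by swapping
   [A] and [B]. *)
Definition dnls_rhs (Omega gamma epsilon : R) (A B : Z -> C) (n : Z) : C :=
  (epsilon * (A (n + 1)%Z - 2 * A n + A (n - 1)%Z) + Omega * A n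
   + gamma * (Cconj (B n) - Cconj (A n))
   + (1 / 2) * (Cmod (A n) ^ 2)%R * A n)%C.

(* [dA] and [dB] are derivatives in the norm of l^2(Z); since evaluation at [n] is
   bounded and linear, [dA t n] is in particular the derivative of [fun s => A s n]. *)
Definition is_C1_solution (Omega gamma epsilon : R) (A B : R -> ell2) : Prop :=
  exists dA dB : R -> ell2,
    is_C1 (V := prod_NormedModule R_AbsRing ell2_NormedModule ell2_NormedModule)
      (fun t => (A t, B t)) (fun t => (dA t, dB t)) /\
    forall (t : R) (n : Z),
      (Ci * dA t n)%C = dnls_rhs Omega gamma epsilon (A t) (B t) n /\
      (Ci * dB t n)%C = dnls_rhs Omega gamma epsilon (B t) (A t) n.

(* Main.v *)
(* The system is Hamiltonian, with conserved energy
   sum_n [Omega (|A_n|^2 + |B_n|^2) + (|A_n|^4 + |B_n|^4) / 4 - gamma Re (A_n - B_n)^2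
          - epsilon (|A_{n+1} - A_n|^2 + |B_{n+1} - B_n|^2)],
   which dominates (Omega - 2 gamma - 4 epsilon) (|A|^2 + |B|^2).  To differentiate finite
   sums only, restrict it to the sites [-N-1, N] and the bonds between them: the bounds
   persist, and the time derivative is a flux through the two ends of the window.  The
   fluxes of distinct windows involve distinct sites, so their sum over N = L, ..., L + M
   is bounded on compact time intervals uniformly in M; averaging over N and letting M tend
   to infinity makes the flux disappear. *)

Require Import Defs.
From Stdlib Require Import Lra Lia.

(** * Sums over finite windows of the lattice *)

(* The sites of [window f N] are [-N-1, ..., N]; its two end sites are those of
   [ends f N]. *)
Definition window (f : Z -> R) (N : nat) : R := sum_n (zpos f) N + sum_n (zneg f) N.

Definition ends (f : Z -> R) (N : nat) : R := zpos f N + zneg f N.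

Lemma window_O (f : Z -> R) : window f 0 = ends f 0.
Proof. unfold window, ends. now rewrite !sum_O. Qed.

Lemma window_S (f : Z -> R) (N : nat) : window f (S N) = window f N + ends f (S N).
Proof. unfold window, ends. rewrite !sum_Sn. unfold plus; simpl. ring. Qed.

Lemma window_ext (f g : Z -> R) (N : nat) :
  (forall n, f n = g n) -> window f N = window g N.
Proof.
  intros H. unfold window.
  f_equal; apply sum_n_ext; intros k; apply H.
Qed.

Lemma window_plus (f g : Z -> R) (N : nat) :
  window (fun n => f n + g n) N = window f N + window g N.
Proof.
  induction N as [|N IH]; [rewrite !window_O | rewrite !window_S, IH];
    unfold ends, zpos, zneg; ring.
Qed.

Lemma window_scal (c : R) (f : Z -> R) (N : nat) :
  window (fun n => c * f n) N = c * window f N.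
Proof.
  induction N as [|N IH]; [rewrite !window_O | rewrite !window_S, IH];
    unfold ends, zpos, zneg; ring.
Qed.

Lemma window_le (f g : Z -> R) (N : nat) :
  (forall n, f n <= g n) -> window f N <= window g N.
Proof.
  intros H. unfold window.
  apply Rplus_le_compat; apply sum_n_m_le; intros k; apply H.
Qed.

(** The shifted window gains the site N+1 and loses the site -N-1. This turns the sum of a discrete
    divergence into two boundary terms. *)
Lemma window_shift (f : Z -> R) (N : nat) :
  window (fun n => f (n + 1)%Z) N
  = window f N + f (Z.of_nat (S N)) - f (- Z.of_nat (S N))%Z.
Proof.
  induction N as [|N IH].
  - rewrite !window_O; unfold ends, zpos, zneg; simpl. ring.
  - rewrite !window_S, IH; unfold ends, zpos, zneg.
    replace (Z.of_nat (S N) + 1)%Z with (Z.of_nat (S (S N))) by lia.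
    replace (- Z.of_nat (S (S N)) + 1)%Z with (- Z.of_nat (S N))%Z by lia.
    ring.
Qed.

Lemma ends_ge0 (f : Z -> R) (N : nat) : (forall n, 0 <= f n) -> 0 <= ends f N.
Proof. intros H. apply Rplus_le_le_0_compat; apply H. Qed.

Lemma window_incr (f : Z -> R) (N M : nat) :
  (forall n, 0 <= f n) -> window f N <= window f (N + M).
Proof.
  intros H. induction M as [|M IH]; [rewrite Nat.add_0_r; lra|].
  rewrite Nat.add_succ_r, window_S.
  pose proof (ends_ge0 f (S (N + M)) H). lra.
Qed.

Lemma ends_le_window (f : Z -> R) (N : nat) :
  (forall n, 0 <= f n) -> ends f N <= window f N.
Proof.
  intros H. destruct N as [|N]; [rewrite window_O; lra|].
  rewrite window_S. pose proof (window_incr f 0 N H) as L.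
  rewrite window_O in L. pose proof (ends_ge0 f 0 H). simpl in L. lra.
Qed.

Lemma is_lim_seq_window (f : Z -> R) :
  ex_seriesZ f -> is_lim_seq (window f) (SeriesZ f).
Proof.
  intros [Hp Hn].
  apply (is_lim_seq_plus' (sum_n (zpos f)) (sum_n (zneg f)));
    apply Series_correct; assumption.
Qed.

Lemma window_le_SeriesZ (f : Z -> R) (N : nat) :
  (forall n, 0 <= f n) -> ex_seriesZ f -> window f N <= SeriesZ f.
Proof.
  intros H Hf. apply (is_lim_seq_incr_compare (window f) (SeriesZ f)).
  - now apply is_lim_seq_window.
  - intros n. rewrite window_S. pose proof (ends_ge0 f (S n) H). lra.
Qed.

Lemma SeriesZ_le_of_window (f : Z -> R) (K : R) :
  ex_seriesZ f -> (forall N, window f N <= K) -> SeriesZ f <= K.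
Proof.
  intros Hf H.
  exact (is_lim_seq_le (window f) (fun _ => K) (SeriesZ f) K H
           (is_lim_seq_window f Hf) (is_lim_seq_const K)).
Qed.

(** Windows of different sizes have disjoint pairs of end sites, all inside the largest window, so
    the bound depends neither on [L] nor on [M]. *)
Lemma sum_ends_le_SeriesZ (f : Z -> R) (L M : nat) :
  (forall n, 0 <= f n) -> ex_seriesZ f ->
  sum_n (fun j => ends f (L + j)) M <= SeriesZ f.
Proof.
  intros H Hf. apply Rle_trans with (window f (L + M)); [|now apply window_le_SeriesZ].
  induction M as [|M IH].
  - rewrite sum_O. now apply ends_le_window.
  - rewrite sum_Sn, Nat.add_succ_r, window_S. unfold plus; simpl. lra.
Qed.

Lemma is_derive_sum (f : nat -> R -> R) (f' : nat -> R) (t : R) (N : nat) :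
  (forall k, is_derive (f k) t (f' k)) ->
  is_derive (fun s => sum_n (fun k => f k s) N) t (sum_n f' N).
Proof.
  intros H. apply (is_derive_sum_n f N t f'). intros k _. apply H.
Qed.

Lemma is_derive_window (f : Z -> R -> R) (f' : Z -> R) (t : R) (N : nat) :
  (forall n, is_derive (f n) t (f' n)) ->
  is_derive (fun s => window (fun n => f n s) N) t (window f' N).
Proof.
  intros H. unfold window.
  apply (is_derive_plus (V := R_NormedModule));
  [apply (is_derive_sum (fun k => f (Z.of_nat k)) (zpos f'))
  |apply (is_derive_sum (fun k => f (- Z.of_nat (S k))%Z) (zneg f'))];
  intros k; apply H.
Qed.

(** * The energy of a window and its bounds *)

Lemma Cmod_sq (z : C) : Cmod z ^ 2 = fst z ^ 2 + snd z ^ 2.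
Proof. apply pow2_sqrt. nra. Qed.

(** The Euclidean inner product of the plane, that is Re (z conj w). *)
Definition cdot (z w : C) : R := fst z * fst w + snd z * snd w.

Lemma Rabs_cdot_le (z w : C) : 2 * Rabs (cdot z w) <= Cmod z ^ 2 + Cmod w ^ 2.
Proof. rewrite !Cmod_sq. unfold cdot.
  pose proof (pow2_ge_0 (fst z - fst w)). pose proof (pow2_ge_0 (fst z + fst w)).
  pose proof (pow2_ge_0 (snd z - snd w)). pose proof (pow2_ge_0 (snd z + snd w)).
  unfold Rabs. destruct Rcase_abs; lra. Qed.

Lemma Cmod_minus_sq (z w : C) : Cmod (z - w) ^ 2 <= 2 * (Cmod z ^ 2 + Cmod w ^ 2).
Proof.
  pose proof (Cmod_plus_sq 1 z (- w)%C Rlt_0_1) as H.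
  rewrite Cmod_opp in H. fold (z - w)%C in H. lra.
Qed.

Definition bond (A : Z -> C) (n : Z) : R := Cmod (A (n + 1)%Z - A n) ^ 2.

Definition onsite (Omega gamma : R) (a b : C) : R :=
  Omega * (Cmod a ^ 2 + Cmod b ^ 2) + / 4 * ((Cmod a ^ 2) ^ 2 + (Cmod b ^ 2) ^ 2)
  - gamma * (fst (a - b)%C ^ 2 - snd (a - b)%C ^ 2).

(* The last summand removes the bond joining [N] to [N + 1], so that only
   bonds inside [-N-1, N] are counted. *)
Definition energy (Omega gamma epsilon : R) (A B : Z -> C) (N : nat) : R :=
  window (fun n => onsite Omega gamma (A n) (B n) - epsilon * (bond A n + bond B n)) N
  + epsilon * (bond A (Z.of_nat N) + bond B (Z.of_nat N)).

Definition mass (A B : Z -> C) (n : Z) : R := Cmod (A n) ^ 2 + Cmod (B n) ^ 2.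

Lemma mass_ge0 (A B : Z -> C) (n : Z) : 0 <= mass A B n.
Proof. apply Rplus_le_le_0_compat; apply pow2_ge_0. Qed.

Lemma ex_seriesZ_mass (A B : ell2) : ex_seriesZ (mass A B).
Proof. apply ex_seriesZ_plus; apply ell2_summable. Qed.

Lemma SeriesZ_mass (A B : ell2) : SeriesZ (mass A B) = norm A ^ 2 + norm B ^ 2.
Proof.
  unfold mass. rewrite SeriesZ_plus by apply ell2_summable.
  unfold norm; simpl NormedModule.norm. now rewrite !ell2_norm_sq.
Qed.

Lemma bond_mass (A B : Z -> C) (n : Z) :
  bond A n + bond B n <= 2 * (mass A B (n + 1) + mass A B n).
Proof.
  unfold bond, mass.
  pose proof (Cmod_minus_sq (A (n + 1)%Z) (A n)).
  pose proof (Cmod_minus_sq (B (n + 1)%Z) (B n)). lra.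
Qed.

Lemma bond_ge0 (A : Z -> C) (n : Z) : 0 <= bond A n.
Proof. apply pow2_ge_0. Qed.


(** An interior bond costs at most twice the mass of its two sites. Inner sites belong to two such
    bonds but end sites to only one, whence [- 2 * ends]; in the induction this reserve pays for the
    new bonds at the old end sites. *)
Lemma interior_bonds_le (A B : Z -> C) (N : nat) :
  window (fun n => bond A n + bond B n) N - (bond A (Z.of_nat N) + bond B (Z.of_nat N))
  <= 4 * window (mass A B) N - 2 * ends (mass A B) N.
Proof.
  induction N as [|N IH].
  - rewrite !window_O; unfold ends, zpos, zneg.
    pose proof (bond_mass A B (-1)) as H. simpl in *. lra.
  - rewrite !window_S; unfold ends, zpos, zneg in *.
    pose proof (bond_mass A B (Z.of_nat N)) as H1.
    pose proof (bond_mass A B (- Z.of_nat (S (S N)))) as H2.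
    replace (Z.of_nat N + 1)%Z with (Z.of_nat (S N)) in H1 by lia.
    replace (- Z.of_nat (S (S N)) + 1)%Z with (- Z.of_nat (S N))%Z in H2 by lia.
    lra.
Qed.

Lemma onsite_ge (Omega gamma : R) (a b : C) : 0 <= gamma ->
  (Omega - 2 * gamma) * (Cmod a ^ 2 + Cmod b ^ 2) <= onsite Omega gamma a b.
Proof.
  intros Hg. unfold onsite. pose proof (Cmod_minus_sq a b) as H.
  rewrite (Cmod_sq (a - b)) in H.
  pose proof (pow2_ge_0 (Cmod a ^ 2)). pose proof (pow2_ge_0 (Cmod b ^ 2)).
  pose proof (pow2_ge_0 (snd (a - b)%C)).
  assert (gamma * (fst (a - b)%C ^ 2 - snd (a - b)%C ^ 2)
          <= gamma * (2 * (Cmod a ^ 2 + Cmod b ^ 2)))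
    by (apply Rmult_le_compat_l; lra).
  lra.
Qed.

Lemma onsite_le (Omega gamma : R) (a b : C) : 0 <= gamma ->
  onsite Omega gamma a b
  <= (Omega + 2 * gamma + (Cmod a ^ 2 + Cmod b ^ 2) / 4) * (Cmod a ^ 2 + Cmod b ^ 2).
Proof.
  intros Hg. unfold onsite. pose proof (Cmod_minus_sq a b) as H.
  rewrite (Cmod_sq (a - b)) in H.
  pose proof (Rmult_le_pos _ _ (pow2_ge_0 (Cmod a)) (pow2_ge_0 (Cmod b))).
  pose proof (pow2_ge_0 (fst (a - b)%C)).
  assert (- gamma * (fst (a - b)%C ^ 2 - snd (a - b)%C ^ 2)
          <= gamma * (2 * (Cmod a ^ 2 + Cmod b ^ 2))).
  { replace (- gamma * (fst (a - b)%C ^ 2 - snd (a - b)%C ^ 2))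
      with (gamma * (snd (a - b)%C ^ 2 - fst (a - b)%C ^ 2)) by ring.
    apply Rmult_le_compat_l; lra. }
  lra.
Qed.

Lemma energy_split (Omega gamma epsilon : R) (A B : Z -> C) (N : nat) :
  energy Omega gamma epsilon A B N
  = window (fun n => onsite Omega gamma (A n) (B n)) N
    - epsilon * (window (fun n => bond A n + bond B n) N
                 - (bond A (Z.of_nat N) + bond B (Z.of_nat N))).
Proof.
  unfold energy.
  rewrite (window_ext _ (fun n => onsite Omega gamma (A n) (B n)
                                  + (- epsilon) * (bond A n + bond B n)))
    by (intros; ring).
  rewrite window_plus, window_scal. ring.
Qed.

(** The coupling of the components costs at most 2 gamma times the mass, the bonds at most 4 epsilon
    times, and the quartic part is nonnegative; hence the threshold on Omega. *)
Lemma energy_ge (Omega gamma epsilon : R) (A B : Z -> C) (N : nat) :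
  0 <= gamma -> 0 <= epsilon ->
  (Omega - 2 * gamma - 4 * epsilon) * window (mass A B) N
  <= energy Omega gamma epsilon A B N.
Proof.
  intros Hg He. rewrite energy_split.
  pose proof (window_le (fun n => (Omega - 2 * gamma) * mass A B n) _ N
    (fun n => onsite_ge Omega gamma (A n) (B n) Hg)) as H.
  rewrite window_scal in H.
  pose proof (Rmult_le_compat_l _ _ _ He (interior_bonds_le A B N)).
  pose proof (Rmult_le_pos _ _ He (ends_ge0 (mass A B) N (mass_ge0 A B))).
  lra.
Qed.

Lemma energy_le (Omega gamma epsilon : R) (A B : ell2) (N : nat) :
  0 <= gamma -> 0 <= epsilon -> 0 <= Omega ->
  let S := SeriesZ (mass A B) in
  energy Omega gamma epsilon A B N <= (Omega + 2 * gamma + S / 4) * S.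
Proof.
  intros Hg He HO S. rewrite energy_split.
  assert (mS : forall n, mass A B n <= S)
    by (intros n; apply term_le_SeriesZ; [apply mass_ge0 | apply ex_seriesZ_mass]).
  assert (S0 : 0 <= S) by (eapply Rle_trans; [apply (mass_ge0 A B 0) | apply mS]).
  assert (H : window (fun n => onsite Omega gamma (A n) (B n)) N
              <= window (fun n => (Omega + 2 * gamma + S / 4) * mass A B n) N).
  { apply window_le; intros n.
    eapply Rle_trans; [now apply onsite_le|]. fold (mass A B n).
    apply Rmult_le_compat_r; [apply mass_ge0 | specialize (mS n); lra]. }
  rewrite window_scal in H.
  assert (W : window (mass A B) N <= S)
    by (apply window_le_SeriesZ; [apply mass_ge0 | apply ex_seriesZ_mass]).
  assert (0 <= Omega + 2 * gamma + S / 4) as Hc by lra.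
  pose proof (Rmult_le_compat_l _ _ _ Hc W).
  assert (b0 : forall n, 0 <= bond A n + bond B n)
    by (intros n; apply Rplus_le_le_0_compat; apply bond_ge0).
  (* The outgoing bond at N, which is subtracted, is itself a term of the window sum, so the
     remaining sum of bonds is nonnegative. *)
  pose proof (ends_le_window _ N b0) as HB. unfold ends, zpos, zneg in HB.
  specialize (b0 (- Z.of_nat (Datatypes.S N))%Z).
  assert (0 <= epsilon * (window (fun n => bond A n + bond B n) N
                 - (bond A (Z.of_nat N) + bond B (Z.of_nat N))))
    by (apply Rmult_le_pos; lra).
  lra.
Qed.

(** * Time derivative of the energy of a window *)

(** The rate at which one component brings energy into the window through the two bonds cut by its
    boundary, from -N-2 to -N-1 and from N to N+1. *)
Definition flux (epsilon : R) (A dA : Z -> C) (N : nat) : R :=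
  2 * epsilon * (cdot (dA (- Z.of_nat (S N))%Z)
                   (A (- Z.of_nat (S N))%Z - A (- Z.of_nat (S (S N)))%Z)%C
                 - cdot (dA (Z.of_nat N)) (A (Z.of_nat (S N)) - A (Z.of_nat N))%C).

Definition is_derive_C (f : R -> C) (t : R) (l : C) : Prop :=
  is_derive (fun s => fst (f s)) t (fst l) /\ is_derive (fun s => snd (f s)) t (snd l).

Lemma is_derive_sq (f : R -> R) (t f' : R) :
  is_derive f t f' -> is_derive (fun s => f s ^ 2) t (2 * (f' * f t)).
Proof.
  intros H. replace (2 * (f' * f t)) with (INR 2 * f' * f t ^ pred 2) by (simpl; ring).
  now apply is_derive_pow.
Qed.

Lemma is_derive_Cmod_sq (f : R -> C) (t : R) (f' : C) :
  is_derive_C f t f' -> is_derive (fun s => Cmod (f s) ^ 2) t (2 * cdot f' (f t)).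
Proof.
  intros [x y].
  eapply is_derive_ext; [intros s; symmetry; apply Cmod_sq|].
  unfold cdot. rewrite Rmult_plus_distr_l.
  apply (is_derive_plus (V := R_NormedModule));
    [exact (is_derive_sq _ _ _ x) | exact (is_derive_sq _ _ _ y)].
Qed.

Lemma is_derive_C_minus (f g : R -> C) (t : R) (f' g' : C) :
  is_derive_C f t f' -> is_derive_C g t g' ->
  is_derive_C (fun s => f s - g s)%C t (f' - g')%C.
Proof.
  intros [x y] [p q].
  split; apply (is_derive_minus (V := R_NormedModule)); assumption.
Qed.

Lemma is_derive_bond (A : R -> Z -> C) (dA : Z -> C) (t : R) (n : Z) :
  (forall n, is_derive_C (fun s => A s n) t (dA n)) ->
  is_derive (fun s => bond (A s) n) t
    (2 * cdot (dA (n + 1)%Z - dA n)%C (A t (n + 1)%Z - A t n)%C).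
Proof.
  intros H. apply (is_derive_Cmod_sq (fun s => A s (n + 1)%Z - A s n)%C).
  now apply is_derive_C_minus.
Qed.

(** The last term comes from Re (a - b)^2, whose derivative is 2 Re ((a' - b') (a - b)); pairing
    with the conjugate in [cdot] produces this real part of a product. *)
Definition donsite (Omega gamma : R) (a b a' b' : C) : R :=
  2 * Omega * (cdot a' a + cdot b' b)
  + (Cmod a ^ 2 * cdot a' a + Cmod b ^ 2 * cdot b' b)
  - 2 * gamma * cdot (a' - b')%C (Cconj (a - b)%C).

Lemma is_derive_onsite (Omega gamma : R) (a b : R -> C) (a' b' : C) (t : R) :
  is_derive_C a t a' -> is_derive_C b t b' ->
  is_derive (fun s => onsite Omega gamma (a s) (b s)) t
    (donsite Omega gamma (a t) (b t) a' b').
Proof.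
  intros Ha Hb. destruct (is_derive_C_minus _ _ _ _ _ Ha Hb) as [Hx Hy].
  apply is_derive_sq in Hx. apply is_derive_sq in Hy.
  apply is_derive_Cmod_sq in Ha. apply is_derive_Cmod_sq in Hb.
  replace (donsite Omega gamma (a t) (b t) a' b') with
    (Omega * (2 * cdot a' (a t) + 2 * cdot b' (b t))
     + / 4 * (2 * (2 * cdot a' (a t) * Cmod (a t) ^ 2)
              + 2 * (2 * cdot b' (b t) * Cmod (b t) ^ 2))
     - gamma * (2 * (fst (a' - b')%C * fst (a t - b t)%C)
                - 2 * (snd (a' - b')%C * snd (a t - b t)%C)))
    by (unfold donsite, cdot, Cconj; simpl fst; simpl snd; field).
  unfold onsite.
  apply (is_derive_minus (V := R_NormedModule)); [apply (is_derive_plus (V := R_NormedModule))|];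
    apply is_derive_scal.
  - now apply (is_derive_plus (V := R_NormedModule)).
  - apply (is_derive_plus (V := R_NormedModule)).
    + exact (is_derive_sq _ _ _ Ha).
    + exact (is_derive_sq _ _ _ Hb).
  - now apply (is_derive_minus (V := R_NormedModule)).
Qed.

(* The work [cdot a' (i a')] done by the full right-hand side vanishes, so only the
   lattice coupling contributes, and it is a discrete divergence. *)
Lemma local_balance (Omega gamma epsilon : R) (A B dA dB : Z -> C) (n : Z) :
  (Ci * dA n)%C = dnls_rhs Omega gamma epsilon A B n ->
  (Ci * dB n)%C = dnls_rhs Omega gamma epsilon B A n ->
  let P n := cdot (dA n) (A n - A (n - 1)%Z)%C + cdot (dB n) (B n - B (n - 1)%Z)%C in
  donsite Omega gamma (A n) (B n) (dA n) (dB n)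
  - epsilon * (2 * cdot (dA (n + 1)%Z - dA n)%C (A (n + 1)%Z - A n)%C
               + 2 * cdot (dB (n + 1)%Z - dB n)%C (B (n + 1)%Z - B n)%C)
  = - 2 * epsilon * P (n + 1)%Z + 2 * epsilon * P n.
Proof.
  intros HA HB P. unfold P. replace (n + 1 - 1)%Z with n by lia.
  unfold donsite, cdot. rewrite !Cmod_sq.
  unfold dnls_rhs in HA, HB. rewrite !Cmod_sq in HA, HB.
  (* The derivatives at n+1 may stay arbitrary: their contributions to the two sides agree, so the
     equations at the site n suffice. *)
  revert HA HB. generalize (A (n + 1)%Z), (A (n - 1)%Z), (B (n + 1)%Z), (B (n - 1)%Z),
    (dA (n + 1)%Z), (dB (n + 1)%Z); intros A1 A2 B1 B2 C1 D1.
  generalize (A n), (B n), (dA n), (dB n); intros [x y] [p q] [x' y'] [p' q'] HA HB.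
  injection HA as HA1 HA2. injection HB as HB1 HB2.
  simpl in *.
  (* Multiplication by i exchanges real and imaginary parts up to sign; solving for the derivatives
     reduces the claim to a polynomial identity. *)
  assert (x' = epsilon * (snd A1 - 2 * y + snd A2) + Omega * y + gamma * (y - q)
     + / 2 * (x ^ 2 + y ^ 2) * y) as E1 by lra.
  assert (y' = - (epsilon * (fst A1 - 2 * x + fst A2) + Omega * x + gamma * (p - x)
     + / 2 * (x ^ 2 + y ^ 2) * x)) as E2 by lra.
  assert (p' = epsilon * (snd B1 - 2 * q + snd B2) + Omega * q + gamma * (q - y)
     + / 2 * (p ^ 2 + q ^ 2) * q) as E3 by lra.
  assert (q' = - (epsilon * (fst B1 - 2 * p + fst B2) + Omega * p + gamma * (x - p)
     + / 2 * (p ^ 2 + q ^ 2) * p)) as E4 by lra.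
  rewrite E1, E2, E3, E4. field.
Qed.

Lemma is_derive_energy (Omega gamma epsilon : R) (A B : R -> Z -> C) (dA dB : Z -> C)
    (t : R) (N : nat) :
  (forall n, is_derive_C (fun s => A s n) t (dA n)) ->
  (forall n, is_derive_C (fun s => B s n) t (dB n)) ->
  (forall n, (Ci * dA n)%C = dnls_rhs Omega gamma epsilon (A t) (B t) n /\
             (Ci * dB n)%C = dnls_rhs Omega gamma epsilon (B t) (A t) n) ->
  is_derive (fun s => energy Omega gamma epsilon (A s) (B s) N) t
    (flux epsilon (A t) dA N + flux epsilon (B t) dB N).
Proof.
  intros HA HB H.
  pose (b n := 2 * cdot (dA (n + 1)%Z - dA n)%C (A t (n + 1)%Z - A t n)%C
               + 2 * cdot (dB (n + 1)%Z - dB n)%C (B t (n + 1)%Z - B t n)%C).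
  pose (P n := cdot (dA n) (A t n - A t (n - 1)%Z)%C
               + cdot (dB n) (B t n - B t (n - 1)%Z)%C).
  assert (Hb : forall n, is_derive (fun s => bond (A s) n + bond (B s) n) t (b n))
    by (intros n; apply (is_derive_plus (V := R_NormedModule)); now apply is_derive_bond).
  (* The sum of the local balances telescopes to P at -N-1 and N+1. Restoring the bond from N to N+1
     trades the derivative at N+1 for the one at N, so only derivatives at the end sites of the
     window remain. *)
  assert (E : flux epsilon (A t) dA N + flux epsilon (B t) dB N
    = window (fun n => donsite Omega gamma (A t n) (B t n) (dA n) (dB n)
                       - epsilon * b n) N + epsilon * b (Z.of_nat N)).
  { rewrite (window_ext _ (fun n => (- 2 * epsilon) * P (n + 1)%Z + (2 * epsilon) * P n))
      by (intros n; apply (local_balance Omega gamma epsilon (A t) (B t) dA dB); apply H).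
    rewrite window_plus, !window_scal, window_shift.
    unfold flux, b, P.
    replace (Z.of_nat (S N) - 1)%Z with (Z.of_nat N) by lia.
    replace (Z.of_nat N + 1)%Z with (Z.of_nat (S N)) by lia.
    replace (- Z.of_nat (S N) - 1)%Z with (- Z.of_nat (S (S N)))%Z by lia.
    unfold cdot; simpl fst; simpl snd. ring. }
  rewrite E. unfold energy. apply (is_derive_plus (V := R_NormedModule)).
  - apply (is_derive_window (fun n s => onsite Omega gamma (A s n) (B s n)
                               - epsilon * (bond (A s) n + bond (B s) n))).
    intros n. apply (is_derive_minus (V := R_NormedModule)).
    + now apply is_derive_onsite.
    + now apply is_derive_scal.
  - now apply is_derive_scal.
Qed.

(** * Bounds on the fluxes *)

(** Young's inequality replaces the products by squares at a few sites near the boundary, which are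
    summable in [N]. *)
Lemma Rabs_flux_le (epsilon : R) (A dA B dB : Z -> C) (N : nat) : 0 <= epsilon ->
  Rabs (flux epsilon A dA N + flux epsilon B dB N)
  <= epsilon * (ends (mass dA dB) N
                + 2 * (ends (mass A B) N + ends (mass A B) (S N))).
Proof.
  intros He.
  assert (K : forall X dX : Z -> C, Rabs (flux epsilon X dX N)
    <= epsilon * (ends (fun n => Cmod (dX n) ^ 2) N
         + 2 * (ends (fun n => Cmod (X n) ^ 2) N + ends (fun n => Cmod (X n) ^ 2) (S N)))).
  { intros X dX. unfold flux, ends, zpos, zneg.
    pose proof (Rabs_cdot_le (dX (- Z.of_nat (S N))%Z)
      (X (- Z.of_nat (S N))%Z - X (- Z.of_nat (S (S N)))%Z)%C).
    pose proof (Rabs_cdot_le (dX (Z.of_nat N)) (X (Z.of_nat (S N)) - X (Z.of_nat N))%C).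
    pose proof (Cmod_minus_sq (X (- Z.of_nat (S N))%Z) (X (- Z.of_nat (S (S N)))%Z)).
    pose proof (Cmod_minus_sq (X (Z.of_nat (S N))) (X (Z.of_nat N))).
    rewrite !Rabs_mult, (Rabs_pos_eq 2), (Rabs_pos_eq epsilon) by lra.
    rewrite (Rmult_comm 2 epsilon), Rmult_assoc. apply Rmult_le_compat_l; [exact He|].
    unfold Rminus at 1.
    eapply Rle_trans;
      [apply Rmult_le_compat_l; [lra | apply Rabs_triang]|].
    rewrite Rabs_Ropp. lra. }
  eapply Rle_trans; [apply Rabs_triang|].
  pose proof (K A dA). pose proof (K B dB).
  unfold mass, ends, zpos, zneg in *. lra.
Qed.

Lemma Rabs_sum_flux_le (epsilon : R) (A dA B dB : ell2) (L M : nat) : 0 <= epsilon ->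
  Rabs (sum_n (fun j => flux epsilon A dA (L + j) + flux epsilon B dB (L + j)) M)
  <= epsilon * (SeriesZ (mass dA dB) + 4 * SeriesZ (mass A B)).
Proof.
  intros He.
  pose proof (sum_ends_le_SeriesZ _ L M (mass_ge0 dA dB) (ex_seriesZ_mass dA dB)) as HQ.
  pose proof (sum_ends_le_SeriesZ _ L M (mass_ge0 A B) (ex_seriesZ_mass A B)) as HS.
  (* The flux of window N also reads the sites N+1 and -N-2, which are the ends of the next window;
     hence a second family, shifted by one. *)
  pose proof (sum_ends_le_SeriesZ _ (S L) M (mass_ge0 A B) (ex_seriesZ_mass A B)) as HS'.
  apply Rle_trans with (epsilon * (sum_n (fun j => ends (mass dA dB) (L + j)) M
    + 2 * (sum_n (fun j => ends (mass A B) (L + j)) M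
           + sum_n (fun j => ends (mass A B) (S L + j)) M))).
  - clear HQ HS HS'. induction M as [|M IH].
    + rewrite !sum_O. now apply Rabs_flux_le.
    + rewrite !sum_Sn. repeat change (plus ?x ?y) with (x + y).
      change (S L + S M)%nat with (S (L + S M)).
      eapply Rle_trans; [apply Rabs_triang|].
      pose proof (Rabs_flux_le epsilon A dA B dB (L + S M) He) as H.
      eapply Rle_trans; [apply Rplus_le_compat; [exact IH | exact H]|].
      lra.
  - apply Rmult_le_compat_l; lra.
Qed.

(** * From derivatives in the norm to derivatives of coordinates *)

(** Here [i] stands for the real or the imaginary part. Boundedness holds with constant 1 because a
    single squared modulus is at most the whole sum. *)
Lemma is_linear_coord (i : C -> R) (n : Z) :
  (forall z w, i (z + w)%C = i z + i w) ->
  (forall (c : R) z, i (c * z)%C = c * i z) ->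
  (forall z, Rabs (i z) <= Cmod z) ->
  is_linear (K := R_AbsRing) (U := ell2_NormedModule) (V := R_NormedModule)
    (fun A : ell2 => i (A n)).
Proof.
  intros Hp Hs Hb. split.
  - intros x y. apply Hp.
  - intros k x. apply Hs.
  - exists 1. split; [lra|]. intros A. rewrite Rmult_1_l.
    change (Rabs (i (A n)) <= ell2_norm A).
    eapply Rle_trans; [apply Hb|].
    apply Rsqr_incr_0_var; [|apply ell2_norm_ge0]. rewrite !Rsqr_pow2, ell2_norm_sq.
    apply (term_le_SeriesZ (fun n => Cmod (A n) ^ 2)); [|apply ell2_summable].
    intros m; apply pow2_ge_0.
Qed.

Lemma is_derive_linear {U V : NormedModule R_AbsRing} (l : U -> V) (f : R -> U)
    (t : R) (f' : U) :
  is_linear l -> is_derive f t f' -> is_derive (fun s => l (f s)) t (l f').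
Proof.
  intros Hl Hf. unfold is_derive.
  apply filterdiff_ext_lin with (fun y => l (scal y f')).
  - apply (filterdiff_comp' f l t _ l); [exact Hf | now apply filterdiff_linear].
  - intros y. apply linear_scal; exact Hl.
Qed.

Lemma is_derive_coord (A : R -> ell2) (t : R) (dA : ell2) (n : Z) :
  is_derive (V := ell2_NormedModule) A t dA ->
  is_derive_C (fun s => A s n) t (dA n).
Proof.
  intros H. split.
  - apply (is_derive_linear (U := ell2_NormedModule) (V := R_NormedModule)
             (fun A : ell2 => fst (A n))); [|exact H].
    apply is_linear_coord; [reflexivity | intros; simpl; ring |].
    intros z. eapply Rle_trans; [apply Rmax_l | apply Rmax_Cmod].
  - apply (is_derive_linear (U := ell2_NormedModule) (V := R_NormedModule)
             (fun A : ell2 => snd (A n))); [|exact H].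
    apply is_linear_coord; [reflexivity | intros; simpl; ring |].
    intros z. eapply Rle_trans; [apply Rmax_r | apply Rmax_Cmod].
Qed.

(** * Averaging over windows and the global bound *)

(** The norm of the product space is the Euclidean combination of the two norms, so a bound on the
    pair controls the sum of squares without loss. *)
Lemma norm_pair_sq (p : ell2 * ell2) :
  norm (fst p) ^ 2 + norm (snd p) ^ 2
  = norm (p : prod_NormedModule R_AbsRing ell2_NormedModule ell2_NormedModule) ^ 2.
Proof.
  symmetry. apply pow2_sqrt.
  apply Rplus_le_le_0_compat; apply pow2_ge_0.
Qed.

Lemma continuous_bounded {V : NormedModule R_AbsRing} (f : R -> V) (a b : R) :
  (forall t, continuous f t) -> exists M, forall t, a <= t <= b -> norm (f t) <= M.
Proof.
  intros H. destruct (bounded_continuity f a b) as [M HM].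
  - intros t _. apply H.
  - exists M. intros t Ht. left. now apply HM.
Qed.

(** This is the averaging: after division by M+1 the fixed error [b] vanishes as M tends to
    infinity. *)
Lemma le_of_affine_bound (x y b : R) :
  (forall M : nat, INR (S M) * x <= INR (S M) * y + b) -> x <= y.
Proof.
  intros H. apply Rnot_lt_le. intros Hlt.
  destruct (INR_unbounded (b / (x - y))) as [M HM].
  specialize (H M). rewrite S_INR in H.
  apply Rlt_div_l in HM; [|lra]. lra.
Qed.

Lemma mass_window_bound (Omega gamma epsilon : R) (A B : R -> ell2) (tau : R) (L : nat) :
  0 <= gamma -> 0 <= epsilon -> 0 < Omega - 2 * gamma - 4 * epsilon ->
  is_C1_solution Omega gamma epsilon A B ->
  let S := SeriesZ (mass (A 0) (B 0)) in
  (Omega - 2 * gamma - 4 * epsilon) * window (mass (A tau) (B tau)) L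
  <= (Omega + 2 * gamma + S / 4) * S.
Proof.
  intros Hg He Hc [dA [dB [[Hd Hcont] Heq]]] S0.
  set (V := prod_NormedModule R_AbsRing ell2_NormedModule ell2_NormedModule) in *.
  (* The bounds may depend on [tau]: they enter only the additive error that averaging removes.
     [Rmin] and [Rmax] treat both signs of [tau]. *)
  destruct (continuous_bounded (V := V) (fun t => (dA t, dB t))
              (Rmin 0 tau) (Rmax 0 tau) Hcont) as [MQ HQ].
  destruct (continuous_bounded (V := V) (fun t => (A t, B t))
              (Rmin 0 tau) (Rmax 0 tau)) as [MS HS].
  { intros t. apply ex_derive_continuous. eexists; apply Hd. }
  assert (sq_le : forall x y, 0 <= x <= y -> x ^ 2 <= y ^ 2)
    by (intros x y Hxy; now apply pow_incr).
  set (E t N := energy Omega gamma epsilon (A t) (B t) N).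
  set (F t N := flux epsilon (A t) (dA t) N + flux epsilon (B t) (dB t) N).
  assert (HE : forall t N, is_derive (fun s => E s N) t (F t N)).
  { intros t N. apply is_derive_energy.
    - intros n. apply is_derive_coord.
      apply (is_derive_linear (U := V) fst _ _ _ is_linear_fst (Hd t)).
    - intros n. apply is_derive_coord.
      apply (is_derive_linear (U := V) snd _ _ _ is_linear_snd (Hd t)).
    - intros n. apply Heq. }
  apply le_of_affine_bound with (epsilon * (MQ ^ 2 + 4 * MS ^ 2) * Rabs tau).
  intros M.
  (* The mean value theorem is applied to the whole sum, since the fluxes of different windows can
     be bounded together only at one common time. That time varies with [M], its flux bound does
     not. *)
  destruct (MVT_gen (fun t => sum_n (fun j => E t (L + j)%nat) M) 0 tau
              (fun t => sum_n (fun j => F t (L + j)%nat) M)) as [t [Ht HM]].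
  { intros t _. apply (is_derive_sum (fun j s => E s (L + j)%nat)). intros j. apply HE. }
  { intros t _. apply continuity_pt_filterlim, (ex_derive_continuous (V := R_NormedModule)).
    eexists. apply (is_derive_sum (fun j s => E s (L + j)%nat)). intros j. apply HE. }
  pose proof (Rabs_sum_flux_le epsilon (A t) (dA t) (B t) (dB t) L M He) as HF.
  rewrite !SeriesZ_mass in HF.
  pose proof (norm_pair_sq (dA t, dB t)) as EQ.
  pose proof (norm_pair_sq (A t, B t)) as ES.
  specialize (HQ t Ht). specialize (HS t Ht).
  apply (fun h => sq_le _ _ (conj (norm_ge_0 _) h)) in HQ, HS.
  simpl fst in *; simpl snd in *.
  (* Every window in the sum contains window [L], whose mass is thus a common lower bound. *)
  assert (Hlow : INR (S M) * ((Omega - 2 * gamma - 4 * epsilon)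
      * window (mass (A tau) (B tau)) L) <= sum_n (fun j => E tau (L + j)%nat) M).
  { rewrite <- sum_n_const. apply sum_n_m_le. intros j.
    eapply Rle_trans; [|now apply energy_ge].
    apply Rmult_le_compat_l; [lra|]. apply window_incr, mass_ge0. }
  assert (Hup : sum_n (fun j => E 0 (L + j)%nat) M
      <= INR (S M) * ((Omega + 2 * gamma + S0 / 4) * S0)).
  { rewrite <- sum_n_const. apply sum_n_m_le. intros j. apply energy_le; lra. }
  rewrite Rminus_0_r in HM.
  assert (sum_n (fun j => F t (L + j)%nat) M * tau
          <= epsilon * (MQ ^ 2 + 4 * MS ^ 2) * Rabs tau).
  { eapply Rle_trans; [apply Rle_abs|]. rewrite Rabs_mult.
    apply Rmult_le_compat_r; [apply Rabs_pos|].
    eapply Rle_trans; [exact HF|]. apply Rmult_le_compat_l; [exact He|].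
    rewrite EQ, ES. apply Rplus_le_compat; [exact HQ|].
    apply Rmult_le_compat_l; [lra | exact HS]. }
  lra.
Qed.

Theorem theorem1 (gamma epsilon Omega : R)
  (gamma_pos : 0 < gamma) (epsilon_pos : 0 < epsilon)
  (Omega_large : Omega > 2 * gamma + 4 * epsilon)
  (A0 B0 : ell2) :
  exists K : R, 0 < K /\
    forall A B : R -> ell2,
      is_C1_solution Omega gamma epsilon A B ->
      A 0 = A0 -> B 0 = B0 ->
      forall tau : R, norm (A tau) ^ 2 + norm (B tau) ^ 2 <= K.
Proof.
  set (c := Omega - 2 * gamma - 4 * epsilon).
  assert (Hc : 0 < c) by (unfold c; lra).
  set (S := SeriesZ (mass A0 B0)).
  assert (HS : 0 <= S) by (apply SeriesZ_pos; [apply mass_ge0 | apply ex_seriesZ_mass]).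
  assert (HK : 0 <= (Omega + 2 * gamma + S / 4) * S / c).
  { apply Rdiv_le_0_compat; [apply Rmult_le_pos; lra | exact Hc]. }
  (* Adding 1 keeps the constant positive for zero initial data. *)
  exists ((Omega + 2 * gamma + S / 4) * S / c + 1). split; [lra|].
  intros A B Hsol HA HB tau. rewrite <- SeriesZ_mass.
  apply SeriesZ_le_of_window; [apply ex_seriesZ_mass|]. intros L.
  apply Rle_trans with ((Omega + 2 * gamma + S / 4) * S / c); [|lra].
  apply Rle_div_r; [exact Hc|]. rewrite Rmult_comm.
  unfold S. rewrite <- HA, <- HB.
  apply (mass_window_bound Omega gamma epsilon); try assumption; lra.
Qed.
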